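(* Let $\Phi$ be a logic program, $A$ an atomic formula and $y$ a term variable not occurring in $A$. Suppose $F(\Phi)\vdash\{A[y]\}\leadsto^*_\gamma\emptyset$. Then there is a proof term $p$ in normal form such that $p:\forall\underline{x}.\ \Rightarrow\gamma A[\gamma y]$ is derivable given axioms $F(\Phi)$, and $\llbracket p\rrbracket_\emptyset=\gamma y$.
   Context: Syntax: first-order terms $t ::= x \mid f(t_1,\dots,t_n)$; atomic formulas $P(t_1,\dots,t_n)$; Horn formulas $[\forall \underline{x}].\ A_1,\dots,A_n \Rightarrow A$ ($n\ge0$). Proof terms $p,e ::= \kappa \mid a \mid \lambda a.e \mid e\ e'$. A logic program is a list of closed Horn formulas labelled by distinct proof-term constants $\kappa$. Typing given axioms $\Psi$: (axiom) $\kappa:\forall\underline{x}.F$ if $(\kappa:\forall\underline{x}.F)\in\Psi$; (gen) $e:F\Rightarrow e:\forall\underline{x}.F$; (inst) $e:\forall\underline{x}.F\Rightarrow e:[\underline{t}/\underline{x}]F$; (cut) from $e_1:\underline{A}\Rightarrow D$, $e_2:\underline{B},D\Rightarrow C$ infer $\lambda\underline{a}.\lambda\underline{b}.(e_2\ \underline{b})(e_1\ \underline{a}):\underline{A},\underline{B}\Rightarrow C$. LP-Unif reduction: $\Psi\vdash\{A_1,\dots,A_i,\dots,A_n\}\leadsto_{\kappa,\gamma\cdot\gamma'}\{\gamma A_1,\dots,\gamma B_1,\dots,\gamma B_m,\dots,\gamma A_n\}$ (current state $\gamma'$) if $\kappa:\forall\underline{x}.B_1,\dots,B_m\Rightarrow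 C\in\Psi$ (variables renamed apart) and $\gamma$ is a most general unifier of $C$ and $A_i$; $\leadsto^*_\gamma$ is a finite sequence of such steps, starting from the empty substitution, with final accumulated state $\gamma$. Representation of first-order normal proof terms (built by application from variables and constants): $\llbracket a\rrbracket_\phi=\phi(a)$, $\llbracket\kappa\ p_1\cdots p_n\rrbracket_\phi=f_\kappa(\llbracket p_1\rrbracket_\phi,\dots,\llbracket p_n\rrbracket_\phi)$ where $f_\kappa$ is a function symbol associated with $\kappa$ ($\emptyset$ is the empty map). For $A\equiv P(t_1,\dots,t_n)$ and $t'$ with free variables disjoint from those of the $t_i$, $A[t']=P(t_1,\dots,t_n,t')$; so $\gamma A[\gamma y]=P(\gamma t_1,\dots,\gamma t_n,\gamma y)$. $F(\Phi)$ replaces each axiom $\kappa:\forall\underline{x}.A_1,\dots,A_m\Rightarrow B$ of $\Phi$ by $\kappa:\forall\underline{x}.\forall\underline{y}.A_1[y_1],\dots,A_m[y_m]\Rightarrow B[f_\kappa(y_1,\dots,y_m)]$ with fresh distinct variables $y_1,\dots,y_m$.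
   Formalization: ''p is derivable'' is read up to beta-reduction: the normal term p is a beta-reduct of a term derivable by the four rules, since cut yields only terms λa.λb.(e2 b)(e1 a) and, for a clause with two premises, κ p1 p2 is not itself derivable. *)

(* Defs.v *)
From mathcomp Require Import all_boot.
From Stdlib Require Import Relation_Operators.
From Stdlib Require List.

Set Implicit Arguments.
Unset Strict Implicit.
Unset Printing Implicit Defensive.

Section Syntax.
Variables F P : Type.

(* Symbols carry no fixed arity: the same predicate symbol occurs in
   [P(t1,..,tn)] and in [P(t1,..,tn,t')]. *)
Inductive term := Var of nat | Fun of F & seq term.

Record atom := Atom { pred_of : P; args : seq term }.

Record sequent := Seqt { prems : seq atom; concl : atom }.

(* [Horn xs S] is [forall xs, S]; the unquantified formula is [Horn [::] S]. *)
Record horn := Horn { bvars : seq nat; body : sequent }.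

Fixpoint vars (t : term) : seq nat :=
  match t with
  | Var x => [:: x]
  | Fun _ ts => flatten (map vars ts)
  end.

Definition avars (A : atom) : seq nat := flatten (map vars (args A)).

Definition svars (S : sequent) : seq nat :=
  flatten (map avars (prems S)) ++ avars (concl S).

Definition closed (h : horn) : Prop := {subset svars (body h) <= bvars h}.

Definition univ_closure (S : sequent) : horn := Horn (svars S) S.

Definition subst := nat -> term.

Fixpoint tsubst (s : subst) (t : term) : term :=
  match t with
  | Var x => s x
  | Fun f ts => Fun f (map (tsubst s) ts)
  end.

Definition asubst (s : subst) (A : atom) : atom :=
  Atom (pred_of A) (map (tsubst s) (args A)).

Definition ssubst (s : subst) (S : sequent) : sequent :=
  Seqt (map (asubst s) (prems S)) (asubst s (concl S)).

(* [comp_subst g g'] is [g . g'], which applies [g'] first. *)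
Definition comp_subst (g g' : subst) : subst := fun x => tsubst g (g' x).

Definition supported (xs : seq nat) (s : subst) : Prop :=
  forall x, x \notin xs -> s x = Var x.

Definition finitely_supported (s : subst) : Prop :=
  exists xs, supported xs s.

Definition unifier (s : subst) (A B : atom) : Prop :=
  finitely_supported s /\ asubst s A = asubst s B.

Definition mgu (s : subst) (A B : atom) : Prop :=
  unifier s A B /\
  forall d, unifier d A B -> exists r, d =1 comp_subst r s.

(* [A[t]] *)
Definition extend (A : atom) (t : term) : atom :=
  Atom (pred_of A) (rcons (args A) t).

End Syntax.

Arguments Var {F}.

Section Programs.
Variables (F P : Type) (K : eqType).

Definition program := seq (K * horn F P).

Definition logic_program (Psi : program) : Prop :=
  uniq (map fst Psi) /\ forall k h, List.In (k, h) Psi -> closed h.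

Definition state := (seq (atom F P) * subst F)%type.

Definition renaming (r : nat -> nat) : subst F := fun x => Var (r x).

(* [x] occurs neither in the domain nor in the range of [g]. *)
Definition apart_from_subst (x : nat) (g : subst F) : Prop :=
  g x = Var x /\ forall z, z != x -> x \notin vars (g z).

(* [r] renames the clause apart from the current state. *)
Definition renames_apart (r : nat -> nat) (xs : seq nat) (st : state) : Prop :=
  {in xs &, injective r} /\
  forall x, x \in xs ->
    r x \notin flatten (map (@avars F P) st.1) /\ apart_from_subst (r x) st.2.

Inductive lp_unif (Psi : program) : state -> state -> Prop :=
| LPUnif k xs Bs C r g g' gs1 A gs2 :
    List.In (k, Horn xs (Seqt Bs C)) Psi ->
    renames_apart r xs (gs1 ++ A :: gs2, g') ->
    mgu g (asubst (renaming r) C) A ->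
    lp_unif Psi
      (gs1 ++ A :: gs2, g')
      (map (asubst g) (gs1 ++ map (asubst (renaming r)) Bs ++ gs2),
       comp_subst g g').

(* [Psi |- gs ~>*_g gs'] *)
Definition lp_unif_star (Psi : program)
    (gs : seq (atom F P)) (g : subst F) (gs' : seq (atom F P)) : Prop :=
  clos_refl_trans_1n _ (lp_unif Psi) (gs, Var) (gs', g).

End Programs.

Section ProofTerms.
Variable K : Type.

(* Evidence variables are de Bruijn indices. *)
Inductive pterm :=
| PConst of K
| PVar of nat
| PLam of pterm
| PApp of pterm & pterm.

Definition papps (p : pterm) (qs : seq pterm) : pterm := foldl PApp p qs.

Fixpoint plift (d c : nat) (p : pterm) : pterm :=
  match p with
  | PConst k => PConst k
  | PVar i => PVar (if i < c then i else i + d)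
  | PLam q => PLam (plift d c.+1 q)
  | PApp q r => PApp (plift d c q) (plift d c r)
  end.

Fixpoint psubst (n : nat) (s p : pterm) : pterm :=
  match p with
  | PConst k => PConst k
  | PVar i => if i < n then PVar i else
              if i == n then plift n 0 s else PVar i.-1
  | PLam q => PLam (psubst n.+1 s q)
  | PApp q r => PApp (psubst n s q) (psubst n s r)
  end.

Inductive beta : pterm -> pterm -> Prop :=
| BetaRedex p q : beta (PApp (PLam p) q) (psubst 0 q p)
| BetaLam p p' : beta p p' -> beta (PLam p) (PLam p')
| BetaAppL p p' q : beta p p' -> beta (PApp p q) (PApp p' q)
| BetaAppR p q q' : beta q q' -> beta (PApp p q) (PApp p q').

Definition beta_star : pterm -> pterm -> Prop := clos_refl_trans_1n _ beta.

Definition normal (p : pterm) : Prop := forall q, ~ beta p q.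

(* [\a1..an. \b1..bm. (e2 b1 .. bm) (e1 a1 .. an)]: under the [n + m] binders,
   [b1..bm] have indices [m-1..0] and [a1..an] have indices [n+m-1..m]. *)
Definition cut_term (n m : nat) (e1 e2 : pterm) : pterm :=
  iter (n + m) PLam
    (PApp (papps (plift (n + m) 0 e2) (map PVar (rev (iota 0 m))))
          (papps (plift (n + m) 0 e1) (map PVar (rev (iota m n))))).

End ProofTerms.

Section Typing.
Variables (F P : Type) (K : eqType).

Inductive has_type (Psi : program F P K) : pterm K -> horn F P -> Prop :=
| TAxiom k h :
    List.In (k, h) Psi -> has_type Psi (PConst k) h
| TGen e xs S :
    has_type Psi e (Horn [::] S) -> has_type Psi e (Horn xs S)
| TInst e xs S s :
    has_type Psi e (Horn xs S) -> supported xs s ->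
    has_type Psi e (Horn [::] (ssubst s S))
| TCut e1 e2 As Bs D C :
    has_type Psi e1 (Horn [::] (Seqt As D)) ->
    has_type Psi e2 (Horn [::] (Seqt (rcons Bs D) C)) ->
    has_type Psi (cut_term (size As) (size Bs) e1 e2)
      (Horn [::] (Seqt (As ++ Bs) C)).

(* Proof terms are read up to beta-reduction.  The cut rule only yields terms
   of the shape of [cut_term]; for a clause with two premises, the normal form
   [k p1 p2] is a reduct of the typed term [(\b. k b p2) p1] but has no typing
   derivation of its own. *)
Definition proves (Psi : program F P K) (p : pterm K) (h : horn F P) : Prop :=
  exists2 e, has_type Psi e h & beta_star e p.

Variable fk : K -> F.

(* [repr_app phi p ts] represents [p p1 .. pn], where [ts] represents
   [p1 .. pn]; it is [None] on terms that are not first-order normal, and on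
   variables outside the domain of [phi]. *)
Fixpoint repr_app (phi : nat -> option (term F)) (p : pterm K)
    (ts : seq (term F)) : option (term F) :=
  match p with
  | PConst k => Some (Fun (fk k) ts)
  | PVar i => if ts is [::] then phi i else None
  | PLam _ => None
  | PApp q r =>
      if repr_app phi r [::] is Some t then repr_app phi q (t :: ts) else None
  end.

Definition represent phi p := repr_app phi p [::].

Definition empty_map : nat -> option (term F) := fun _ => None.

Definition fresh_vars (s : seq nat) (n : nat) : seq nat :=
  iota (\max_(x <- s) x).+1 n.

Definition realize_horn (k : K) (h : horn F P) : horn F P :=
  let: Horn xs (Seqt As B) := h in
  let ys := fresh_vars (xs ++ svars (Seqt As B)) (size As) in
  Horn (xs ++ ys)
    (Seqt [seq extend Ay.1 (Var Ay.2) | Ay <- zip As ys]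
          (extend B (Fun (fk k) (map Var ys)))).

(* [F(Phi)] *)
Definition realize (Phi : program F P K) : program F P K :=
  [seq (kh.1, realize_horn kh.1 kh.2) | kh <- Phi].

End Typing.

Arguments empty_map {F}.

(* Main.v *)
Require Import Defs.
From mathcomp Require Import all_boot.
From Stdlib Require Import Relation_Operators.
From Stdlib Require List.

Set Implicit Arguments.
Unset Strict Implicit.
Unset Printing Implicit Defensive.

(* Let [d] be the substitution accumulated by the part of a reduction that
   starts at an intermediate state.  Backwards along the reduction, every goal
   [G] of that state has a proof [p] of [d G] whose representation is the last
   argument of [d G].  When [G] is resolved against a clause [k] of [F(Phi)]
   with fresh variables [y1 .. ym], the last argument of [d G] is
   [f_k(d y1, .., d ym)], and the proofs [pi] of the new goals represent
   [d yi], so [k p1 .. pm] is the required proof.  The cut rule does not type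
   [k p1 .. pm] directly: cutting the premises away from the last to the first
   gives a term that beta-reduces to it. *)

(** * Substitutions on terms and atoms *)

Section Substitution.
Variables (F P : Type).
Implicit Types (s d : subst F) (t : term F) (A B : atom F P).

Lemma term_nested_ind (Q : term F -> Prop) :
    (forall x, Q (Var x)) ->
    (forall f ts, List.Forall Q ts -> Q (Fun f ts)) ->
  forall t, Q t.
Proof.
move=> QVar QFun; fix IH 1 => -[x|f ts]; first exact: QVar.
by apply: QFun; elim: ts => [|t ts IHts]; constructor.
Qed.

(** The termwise claim is a hypothesis, so that this serves both inside the nested induction on
    terms and for the argument list of an atom. *)
Lemma eq_in_map_tsubst s d (ts : seq (term F)) :
    List.Forall (fun t => {in vars t, s =1 d} -> tsubst s t = tsubst d t) ts ->
    {in flatten (map (@vars F) ts), s =1 d} ->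
  map (tsubst s) ts = map (tsubst d) ts.
Proof.
elim=> //= {}t {}ts IHt _ IHts sd.
congr cons; first by apply: IHt => x tx; apply: sd; rewrite mem_cat tx.
by apply: IHts => x tsx; apply: sd; rewrite mem_cat tsx orbT.
Qed.

Lemma eq_in_tsubst s d t : {in vars t, s =1 d} -> tsubst s t = tsubst d t.
Proof.
elim/term_nested_ind: t => [x|f ts IH] /= sd; first by apply: sd; rewrite inE.
by rewrite (eq_in_map_tsubst IH sd).
Qed.

Lemma eq_in_asubst s d A : {in avars A, s =1 d} -> asubst s A = asubst d A.
Proof.
move=> sd; congr Atom; apply: eq_in_map_tsubst sd.
by apply/List.Forall_forall => t _; apply: eq_in_tsubst.
Qed.

Lemma eq_in_ssubst s d (S : sequent F P) :
  {in svars S, s =1 d} -> ssubst s S = ssubst d S.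
Proof.
case: S => As B; rewrite /svars /ssubst /= => sd; congr Seqt; last first.
  by apply: eq_in_asubst => x Bx; apply: sd; rewrite mem_cat Bx orbT.
have {}sd : {in flatten (map (@avars F P) As), s =1 d}.
  by move=> x Asx; apply: sd; rewrite mem_cat Asx.
elim: As sd => //= A As IH sd.
congr cons; first by apply: eq_in_asubst => x Ax; apply: sd; rewrite mem_cat Ax.
by apply: IH => x Asx; apply: sd; rewrite mem_cat Asx orbT.
Qed.

Lemma eq_asubst s d A : s =1 d -> asubst s A = asubst d A.
Proof. by move=> sd; apply: eq_in_asubst => x _. Qed.

Lemma tsubst_comp s d t : tsubst (comp_subst s d) t = tsubst s (tsubst d t).
Proof.
elim/term_nested_ind: t => //= f ts IH; congr Fun.
by elim: IH => //= {}t {}ts -> _ ->.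
Qed.

Lemma asubst_comp s d A : asubst (comp_subst s d) A = asubst s (asubst d A).
Proof.
rewrite /asubst /= -map_comp; congr Atom.
by apply: eq_map => t; apply: tsubst_comp.
Qed.

Lemma tsubst_Var t : tsubst Var t = t.
Proof.
elim/term_nested_ind: t => //= f ts IH; congr Fun.
by elim: IH => //= {}t {}ts -> _ ->.
Qed.

Lemma asubst_extend s A t :
  asubst s (extend A t) = extend (asubst s A) (tsubst s t).
Proof. by rewrite /asubst /extend /= map_rcons. Qed.

Lemma extend_injr A B t u : extend A t = extend B u -> t = u.
Proof. by case=> _ /rcons_inj []. Qed.

Lemma avars_extend A t : avars (extend A t) = avars A ++ vars t.
Proof. by rewrite /avars /= map_rcons flatten_rcons. Qed.

End Substitution.

(** The new variables [ys] join the binders. Closedness lets [has_type_inst] apply an arbitrary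
    substitution to a clause of the realized program. *)
Lemma realize_closed (F P : Type) (K : eqType) (fk : K -> F) k (h : horn F P) :
  Defs.closed h -> Defs.closed (realize_horn fk k h).
Proof.
case: h => xs [As B]; rewrite /Defs.closed /=; set ys := fresh_vars _ _.
rewrite /svars /= => cl x; rewrite avars_extend /= !mem_cat => /orP[Asx|].
  have [|] : x \in flatten (map (@avars F P) As) \/ x \in ys.
  - elim: (As) (ys) Asx => [|A As' IH] [|y ys'] //=.
    rewrite avars_extend !mem_cat /= !inE => /orP[/orP[->|->]|/IH[]->];
      by rewrite ?orbT; auto.
  - by move=> Ax; rewrite cl // mem_cat Ax.
  - by move->; rewrite orbT.
case/orP=> [Bx|]; first by rewrite cl // mem_cat Bx orbT.
by rewrite -map_comp /comp /= flatten_seq1 => ->; rewrite orbT.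
Qed.

(** * Beta-reduction of cut terms *)

Section Reduction.
Variable K : Type.
Implicit Types (p q e : pterm K) (ps qs es : seq (pterm K)).

(** Typed terms satisfy [pclosed 0], which makes the lifts in [cut_term] and the substitutions of
    beta steps act trivially on them. *)
Fixpoint pclosed c p : bool :=
  match p with
  | PConst _ => true
  | PVar i => i < c
  | PLam q => pclosed c.+1 q
  | PApp q r => pclosed c q && pclosed c r
  end.

Lemma pclosed_le c c' p : c <= c' -> pclosed c p -> pclosed c' p.
Proof.
elim: p c c' => //= [i|q IH|q IHq r IHr] c c' lecc'.
- by move=> ltic; apply: leq_trans lecc'.
- exact: IH.
- by case/andP=> /(IHq _ _ lecc') -> /(IHr _ _ lecc').
Qed.

Lemma plift_closed d c p : pclosed c p -> plift d c p = p.
Proof.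
elim: p c => //= [i|q IH|q IHq r IHr] c; first by move->.
  by move/IH->.
by case/andP=> /IHq -> /IHr ->.
Qed.

Lemma psubst_closed c s p : pclosed c p -> psubst c s p = p.
Proof.
elim: p c => //= [i|q IH|q IHq r IHr] c; first by move->.
  by move/IH->.
by case/andP=> /IHq -> /IHr ->.
Qed.

Lemma papps_rcons p qs q : papps p (rcons qs q) = PApp (papps p qs) q.
Proof. exact: foldl_rcons. Qed.

Lemma pclosed_papps c p qs :
  pclosed c (papps p qs) = pclosed c p && all (pclosed c) qs.
Proof. by elim: qs p => [|q qs IH] p /=; rewrite ?andbT // IH /= andbA. Qed.

Lemma pclosed_lams c n p : pclosed c (iter n (@PLam K) p) = pclosed (n + c) p.
Proof. by elim: n c => //= n IH c; rewrite IH addnS. Qed.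

Lemma psubst_lams c s n p :
  psubst c s (iter n (@PLam K) p) = iter n (@PLam K) (psubst (n + c) s p).
Proof. by elim: n c => //= n IH c; rewrite IH addnS. Qed.

Lemma psubst_papps c s p qs :
  psubst c s (papps p qs) = papps (psubst c s p) (map (psubst c s) qs).
Proof. by elim: qs p => //= q qs IH p; rewrite IH. Qed.

Lemma pclosed_cut_term n m e1 e2 :
  pclosed 0 e1 -> pclosed 0 e2 -> pclosed 0 (cut_term n m e1 e2).
Proof.
move=> cl1 cl2; rewrite /cut_term !plift_closed // pclosed_lams addn0 /=.
rewrite !pclosed_papps !all_map !all_rev.
rewrite (pclosed_le _ cl1) // (pclosed_le _ cl2) //=.
apply/andP; split; apply/allP=> i; rewrite mem_iota /=.
  by move/leq_trans; apply; rewrite leq_addl.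
by rewrite addnC => /andP[].
Qed.

Lemma beta_star_refl p : beta_star p p.
Proof. exact: rt1n_refl. Qed.

Lemma beta_star1 p q : beta p q -> beta_star p q.
Proof. by move=> pq; apply: rt1n_trans pq (beta_star_refl _). Qed.

Lemma beta_star_trans p q r : beta_star p q -> beta_star q r -> beta_star p r.
Proof. by elim=> // {}p p1 {}q step _ IH /IH; apply: rt1n_trans. Qed.

Lemma beta_star_appl p p' q :
  beta_star p p' -> beta_star (PApp p q) (PApp p' q).
Proof.
elim=> [{}p|{}p p1 p2 step _]; first exact: beta_star_refl.
by apply: rt1n_trans; apply: BetaAppL.
Qed.

Lemma beta_star_appr p q q' :
  beta_star q q' -> beta_star (PApp p q) (PApp p q').
Proof.
elim=> [{}q|{}q q1 q2 step _]; first exact: beta_star_refl.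
by apply: rt1n_trans; apply: BetaAppR.
Qed.

Lemma beta_star_papps p p' qs :
  beta_star p p' -> beta_star (papps p qs) (papps p' qs).
Proof. by elim: qs p p' => //= q qs IH p p' /(beta_star_appl q) /IH. Qed.

(* [vs] holds the arguments already consumed by earlier beta steps. *)
Lemma beta_star_lams_papps n e2 e1 vs qs :
    pclosed 0 e2 -> pclosed 0 e1 -> all (pclosed 0) vs -> all (pclosed 0) qs ->
    size qs = n ->
  beta_star
    (papps (iter n (@PLam K)
       (PApp (papps e2 (vs ++ map (@PVar K) (rev (iota 0 n)))) e1)) qs)
    (PApp (papps e2 (vs ++ qs)) e1).
Proof.
move=> cl2 cl1; elim: n vs qs => [|n IH] vs [|q qs] //=.
  by move=> *; apply: beta_star_refl.
(* The outermost of the [n.+1] abstractions binds index [n], the first entry of the reversed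
   list. *)
move=> clvs /andP[clq clqs] [szqs]; rewrite -/(iota 0 n.+1) -[in iota 0 _]addn1.
rewrite iotaD add0n rev_cat /=.
(* One beta step appends [q] to [vs]; the induction hypothesis for [rcons vs q] does the rest. *)
apply: (@beta_star_trans _ (papps (iter n (@PLam K)
   (PApp (papps e2 (rcons vs q ++ map (@PVar K) (rev (iota 0 n)))) e1)) qs));
  last by rewrite -(cat_rcons q); apply: IH; rewrite // all_rcons clq.
apply/beta_star_papps/beta_star1.
set r := (X in beta _ X); set b := (X in PLam X).
suff -> : r = psubst 0 q b by apply: BetaRedex.
have subst_closed p : pclosed 0 p -> psubst n q p = p.
  by move=> clp; apply/psubst_closed/(pclosed_le _ clp).
rewrite /b psubst_lams addn0 /= psubst_papps map_cat /=.
rewrite !subst_closed //= ltnn eqxx plift_closed //.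
rewrite /r cat_rcons; congr (iter n _ (PApp (papps e2 (_ ++ q :: _)) e1)).
  elim: vs clvs {IH r b} => //= v vs IH /andP[clv /IH <-].
  by rewrite subst_closed.
rewrite -map_comp; apply/eq_in_map => i.
by rewrite mem_rev mem_iota /= add0n => ->.
Qed.

(** With first argument [0], [e1] proves a fact without premises, so all [n] binders stand for the
    remaining premises of [e2]. *)
Lemma beta_star_cut_term n e1 e2 qs :
    pclosed 0 e2 -> pclosed 0 e1 -> all (pclosed 0) qs -> size qs = n ->
  beta_star (papps (cut_term 0 n e1 e2) qs) (PApp (papps e2 qs) e1).
Proof.
move=> cl2 cl1 clqs szqs; rewrite /cut_term !plift_closed //=.
exact: (@beta_star_lams_papps n e2 e1 [::]).
Qed.

End Reduction.

(** * Proofs by instantiation and cut *)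

Section Provability.
Variables (F P : Type) (K : eqType).
Implicit Types (Psi : program F P K) (p e : pterm K) (A C : atom F P).

Lemma has_type_closed Psi e (h : horn F P) : has_type Psi e h -> pclosed 0 e.
Proof. by elim=> // *; apply: pclosed_cut_term. Qed.

Lemma proves_cut Psi k (As : seq (atom F P)) C ps :
    has_type Psi (PConst k) (Horn [::] (Seqt As C)) ->
    List.Forall2
      (fun p A => proves Psi p (Horn [::] (Seqt [::] A))) ps As ->
  proves Psi (papps (PConst k) ps) (Horn [::] (Seqt [::] C)).
Proof.
(* Generalised to a term [e] in which the premises after [As] have been cut away already; [qs] are
   the proofs of those premises. *)
move=> typk; suff cut_all e qs :
    has_type Psi e (Horn [::] (Seqt As C)) ->
    (forall es, all (pclosed 0) es -> size es = size As ->
      beta_star (papps e es) (papps (PConst k) (es ++ qs))) ->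
    List.Forall2 (fun p A => proves Psi p (Horn [::] (Seqt [::] A))) ps As ->
  proves Psi (papps (PConst k) (ps ++ qs)) (Horn [::] (Seqt [::] C)).
  move=> psAs; rewrite -[ps]cats0; apply: cut_all typk _ psAs => es _ _.
  by rewrite cats0; apply: beta_star_refl.
elim/last_ind: As ps e qs {typk} => [|As A IH] ps e qs typ red.
  move=> psAs; inversion psAs; exists e => //.
  by apply: (red [::]).
rewrite -cats1 => /List.Forall2_app_inv_r[ps1 [ps2 [psAs [pA ->]]]].
inversion pA as [|p1 A1 ps3 As3 pA1 ps3nil E1 E2]; subst.
inversion ps3nil; subst; case: pA1 => e1 typ1 red1.
have cl1 := has_type_closed typ1; have cl := has_type_closed typ.
(* The cut rule removes the last premise, so [p1] moves from the end of [ps] to the front of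
   [qs]. *)
rewrite -catA; apply: (IH _ (cut_term 0 (size As) e1 e)) => //.
  exact: (TCut typ1 typ).
move=> es cles szes.
apply: beta_star_trans (beta_star_cut_term cl cl1 cles szes) _.
rewrite -papps_rcons.
(* The typed term [e1], known to be closed, is passed first and reduced to [p1] only once it is in
   place. *)
apply: (@beta_star_trans _ _ (papps (PConst k) (rcons es e1 ++ qs))).
  by apply: red; rewrite ?all_rcons ?cl1 // !size_rcons szes.
rewrite cat_rcons /papps !foldl_cat /=.
exact/beta_star_papps/beta_star_appr.
Qed.

Lemma has_type_inst Psi k h (s : subst F) :
    List.In (k, h) Psi -> Defs.closed h ->
  has_type Psi (PConst k) (Horn [::] (ssubst s (body h))).
Proof.
case: h => xs S kh cl /=.
(* [TInst] requires support in [xs]; cutting [s] off outside [xs] does not change its effect on a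
   closed clause. *)
pose s0 x := if x \in xs then s x else Var x.
rewrite -(@eq_in_ssubst _ _ s0); last by move=> x /cl /= xsx; rewrite /s0 xsx.
by apply: TInst (TAxiom kh) _ => x /negPf xsx; rewrite /s0 xsx.
Qed.

(** * Representations and realized goals *)

Variable fk : K -> F.

(** [repr_app] descends into both sides of every application and fails on an abstraction, whereas
    every redex contains one. *)
Lemma repr_app_normal p ts t : repr_app fk empty_map p ts = Some t -> normal p.
Proof.
move=> rp q pq; elim: pq ts t rp => //= {p q}.
- by move=> p q ts t; case: (repr_app _ _ q _).
- by move=> p p' q _ IH ts t; case: (repr_app _ _ q _) => // u; apply: IH.
- by move=> p q q' _ IH ts t; case E: (repr_app _ _ q _) => // _; apply: IH E.
Qed.

Lemma represent_papps_const k ps ts :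
    List.Forall2 (fun p t => represent fk empty_map p = Some t) ps ts ->
  represent fk empty_map (papps (PConst k) ps) = Some (Fun (fk k) ts).
Proof.
(* Generalised over the head [q] and the accumulator [us], which holds the arguments further to the
   right. *)
have repr_papps q us :
    List.Forall2 (fun p t => represent fk empty_map p = Some t) ps ts ->
  repr_app fk empty_map (papps q ps) us = repr_app fk empty_map q (ts ++ us).
  move=> psts; elim: psts q => //= p t {}ps {}ts rp _ IH q.
  by rewrite IH /= -/(represent _ _ p) rp.
by move/repr_papps; rewrite /represent => ->; rewrite /= cats0.
Qed.

Definition realized Psi A : Prop :=
  exists p B t,
    [/\ A = extend B t, proves Psi p (Horn [::] (Seqt [::] A))
      & represent fk empty_map p = Some t].

Lemma realized_clause (Phi : program F P K) k xs Bs C (s : subst F) :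
    logic_program Phi ->
    List.In (k, Horn xs (Seqt Bs C)) (realize fk Phi) ->
    List.Forall (realized (realize fk Phi)) (map (asubst s) Bs) ->
  realized (realize fk Phi) (asubst s C).
Proof.
move=> [_ clPhi] kin; set Psi := realize fk Phi in kin *.
have /List.in_map_iff[[k' h] [[/= kE hE] /clPhi clh]] := kin.
rewrite {k'}kE in hE clh.
have {clh} := realize_closed (fk := fk) (k := k) clh; rewrite hE => clh realBs.
have typk := has_type_inst s kin clh; rewrite /= in typk.
case: h hE => xs' [As B] [_ BsE CE]; move: BsE CE; set ys := fresh_vars _ _.
have szys : size As = size ys by rewrite size_iota.
move=> BsE CE.
(* The premises in [Bs] have the form [extend Ai (Var yi)], so the term represented by the proof of
   the [i]-th instance must be [s yi]. *)
have [ps [psBs psys]] : exists ps,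
    List.Forall2
      (fun p A => proves Psi p (Horn [::] (Seqt [::] A))) ps
      (map (asubst s) Bs) /\
    List.Forall2 (fun p t => represent fk empty_map p = Some t) ps (map s ys).
  rewrite -BsE in realBs *.
  elim: (As) (ys) szys realBs => [|A1 As1 IH] [|y ys1] //=.
    by exists [::].
  case=> szys /List.Forall_cons_iff[[p [D [t [DE pP rp]]]]].
  case/(IH _ szys)=> ps [psBs psys]; exists (p :: ps).
  split; constructor=> //; move: DE; rewrite asubst_extend => /extend_injr /=.
  by move->.
exists (papps (PConst k) ps), (asubst s B), (Fun (fk k) (map s ys)).
split; first by rewrite -CE asubst_extend /= -map_comp.
  exact: proves_cut typk psBs.
exact: represent_papps_const.
Qed.

Lemma realized_goals (Phi : program F P K) (st : state F P) (gamma : subst F) :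
    logic_program Phi ->
    clos_refl_trans_1n _ (lp_unif (realize fk Phi)) st ([::], gamma) ->
  exists2 d, gamma =1 comp_subst d st.2
    & List.Forall (fun A => realized (realize fk Phi) (asubst d A)) st.1.
Proof.
move=> lpPhi; move E: ([::], gamma) => st' red.
elim: red E => [_ <-|{}st st1 {}st' step _ IH /IH] /=.
  by exists Var => // x; rewrite /comp_subst tsubst_Var.
case: step => {st st1 IH} k xs Bs C r g g' gs1 A gs2 kin _ [[_ gCA] _] [d gE].
rewrite /= !map_cat => /List.Forall_app[real1 /List.Forall_app[realBs real2]].
(* The unifier [g] of the first step acts before [d], which collects the later ones. *)
exists (comp_subst d g); first by move=> x; rewrite gE /comp_subst tsubst_comp.
have realg gs : List.Forall (fun A => realized (realize fk Phi) (asubst d A))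
      (map (asubst g) gs) ->
    List.Forall
      (fun A => realized (realize fk Phi) (asubst (comp_subst d g) A)) gs.
  by move/List.Forall_map; apply: List.Forall_impl => B; rewrite asubst_comp.
apply/List.Forall_app; split; first exact: realg.
constructor; last exact: realg.
(* Since [g] unifies the renamed head with [A], the selected goal becomes an instance of [C] under
   the composite of the renaming, [g] and [d]. *)
rewrite asubst_comp -gCA -!asubst_comp; apply: realized_clause lpPhi kin _.
apply/List.Forall_map; move/realg/List.Forall_map: realBs.
by apply: List.Forall_impl => B; rewrite -!asubst_comp.
Qed.

End Provability.

Theorem theorem5 (F P : Type) (K : eqType) (fk : K -> F)
    (Phi : program F P K) (A : atom F P) (y : nat) (gamma : subst F)
    (hPhi : logic_program Phi)
    (hy : y \notin avars A)
    (hred : lp_unif_star (realize fk Phi) [:: extend A (Var y)] gamma [::]) :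
  exists p : pterm K,
    [/\ normal p,
        proves (realize fk Phi) p
          (univ_closure (Seqt [::] (extend (asubst gamma A) (gamma y))))
      & represent fk empty_map p = Some (gamma y)].
Proof.
have [d gE /List.Forall_cons_iff[[p [B [t [BE pP rp]]]] _]] :=
  realized_goals hPhi hred.
(* The initial state carries [Var], so [d] and [gamma] agree pointwise. *)
have dE : asubst d (extend A (Var y)) = extend (asubst gamma A) (gamma y).
  rewrite -[RHS](asubst_extend gamma A (Var y)).
  by apply: eq_asubst => x; rewrite gE.
have tE : t = gamma y.
  by apply: (@extend_injr _ _ B (asubst gamma A)); rewrite -BE.
rewrite dE tE in pP rp; exists p; split=> //; first exact: repr_app_normal rp.
by case: pP => e typ red; exists e => //; apply: TGen.
Qed.
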